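(* Let $T$ be the standard tent map. Then: (i) the set of all mass centers of orbits of $T$, i.e. the set of all limits $\lim_{n\to\infty}\frac{1}{n}\sum_{i=0}^{n-1}T^i(y)$ over those $y\in[0,1]$ for which the limit exists, is the interval $[0,\frac{2}{3}]$; (ii) the set of mass centers of cycles (periodic orbits) of $T$ is a dense subset of $[0,\frac{2}{3}]$; (iii) for every $x\in[0,\frac{2}{3}]$, there are uncountably many orbits of $T$ with mass center $x$; that is, the set of orbits $\{T^i(y): i\ge 0\}$, over those $y\in[0,1]$ with $\lim_{n\to\infty}\frac{1}{n}\sum_{i=0}^{n-1}T^i(y)=x$, is uncountable.
   Context: The standard tent map is $T:[0,1]\to[0,1]$, $T(x)=1-|2x-1|$, i.e. $T(x)=2x$ for $x\in[0,\frac12]$ and $T(x)=2(1-x)$ for $x\in[\frac12,1]$. The orbit of $y\in[0,1]$ is its forward orbit under $T$. If the partial time averages $\frac{1}{n}\sum_{i=0}^{n-1}T^i(y)$ converge as $n\to\infty$, the limit is called the center of mass (mass center) of the orbit of $y$. A cycle is the orbit of a periodic point, i.e. of a point $y$ with $T^k(y)=y$ for some $k\ge1$; its mass center equals $\frac1k\sum_{i=0}^{k-1}T^i(y)$. *)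

(* Defs.v *)
From mathcomp Require Import all_boot all_order all_algebra.
From mathcomp Require Import classical_sets cardinality.
From mathcomp Require Import reals topology normedtype sequences.

Set Implicit Arguments.
Unset Strict Implicit.
Unset Printing Implicit Defensive.

Import Order.TTheory GRing.Theory Num.Theory.
Import numFieldNormedType.Exports.

Local Open Scope classical_set_scope.
Local Open Scope ring_scope.

(* The tent map is a self-map of [0, 1]; it is written here on all of R, and
   the initial points of orbits are restricted to [0, 1] below. *)
Definition tent (R : realType) (x : R) : R := 1 - `|2 * x - 1|.

Definition tent_orbit (R : realType) (y : R) : set R :=
  [set z | exists i : nat, z = iter i (@tent R) y].

(* [arithmetic_mean u n] is the mean of the first n.+1 terms of u, so the
   term of index n below is 1/(n+1) * (y + T y + ... + T^n y). *)
Definition is_mass_center (R : realType) (y m : R) : Prop :=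
  arithmetic_mean (fun i => iter i (@tent R) y) n @[n --> \oo] --> m.

Definition tent_periodic (R : realType) (y : R) : Prop :=
  exists2 k : nat, (1 <= k)%N & iter k (@tent R) y = y.

Definition mass_centers (R : realType) : set R :=
  [set m | exists2 y : R, y \in `[0, 1] & is_mass_center y m].
Arguments mass_centers R : clear implicits.

Definition cycle_mass_centers (R : realType) : set R :=
  [set m | exists y : R,
     [/\ y \in `[0, 1], tent_periodic y & is_mass_center y m]].
Arguments cycle_mass_centers R : clear implicits.

(* Orbits are identified as sets of points: two initial points with the same
   forward orbit count once. *)
Definition orbits_with_mass_center (R : realType) (x : R) : set (set R) :=
  [set O | exists y : R,
     [/\ y \in `[0, 1], is_mass_center y x & O = tent_orbit y]].

(* Main.v *)
Require Import Defs.
From mathcomp Require Import all_boot all_order all_algebra.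
From mathcomp Require Import classical_sets cardinality.
From mathcomp Require Import reals topology normedtype sequences.
From mathcomp Require Import boolp zify ring lra.
Import Order.TTheory GRing.Theory Num.Theory.
Import numFieldNormedType.Exports.
Local Open Scope classical_set_scope.
Local Open Scope ring_scope.

Set Implicit Arguments.
Unset Strict Implicit.
Unset Printing Implicit Defensive.

(** Follow an orbit x_i = T^i y together with a bit sequence e recording on
    which side of 1/2 each x_i lies (1 for the right half).  On the left half
    x_(i+1) - x_i = x_i and on the right half x_i - x_(i+1) = 3 x_i - 2, so
    x_i = 2/3 e_i + h(e_i) (x_(i+1) - x_i) with h(0) = 1 and h(1) = -1/3.
    Summation by parts turns the last term into a sum over the switches of e:
    the orbit sum differs from 2/3 times the number of ones by at most a
    constant times 1 + the number of switches ([orbit_sum_itinerary]).  Hence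
    if ones have density d in e and switches have density 0, the mass center
    of the orbit is 2/3 d.

    Every bit sequence is the itinerary of some point ([coded_point]), so it
    is enough to produce bit sequences.  The greedy sequence [greedy_bit] is
    constant between consecutive squares; at each square it compares the
    number of ones so far with d n and goes on with ones or zeros so as to
    reduce the discrepancy.  Up to time n both the discrepancy and the number
    of switches are O(sqrt n).  The bit at the square itself is left free.

    The three assertions follow.  No mass center exceeds 2/3, because
    T x <= 2 - 2 x makes 3 times the orbit sum telescope, and every point of
    [0, 2/3] is 2/3 d for some density d.  Repeating a long prefix of a greedy
    sequence gives a cycle whose mean is governed by that prefix, hence is
    close to 2/3 d.  Finally the free bits encode an arbitrary w : nat -> bool
    injectively in a point with mass center 2/3 d; an orbit is countable, so
    countably many orbits would contain only countably many of these points,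
    against Cantor's theorem. *)

(** * Itineraries *)

(** The midpoint 1/2 lies on both sides, so that closed conditions suffice and
    every bit sequence is realized; the price is that a point may have two
    itineraries. *)
Definition on_side (R : realType) (b : bool) (x : R) : bool :=
  if b then 1 / 2 <= x else x <= 1 / 2.

Definition itinerary (R : realType) (n : nat) (e : nat -> bool) (y : R) :=
  forall i, (i < n)%N -> on_side (e i) (iter i (@tent R) y).

Lemma tent_on_side (R : realType) (b : bool) (x : R) :
  on_side b x -> tent x = if b then 2 - 2 * x else 2 * x.
Proof.
rewrite /on_side /tent; case: b => hx.
  by rewrite ger0_norm; lra.
by rewrite ler0_norm; lra.
Qed.

Lemma tent_le (R : realType) (x : R) : tent x <= 2 - 2 * x.
Proof. by rewrite /tent; have := ler_norm (2 * x - 1); lra. Qed.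

Lemma tent_itv (R : realType) (x : R) : 0 <= x <= 1 -> 0 <= tent x <= 1.
Proof.
move=> /andP[x0 x1]; rewrite /tent.
have : `|2 * x - 1| <= 1 by rewrite ler_norml; lra.
by have := normr_ge0 (2 * x - 1); lra.
Qed.

Lemma iter_tent_itv (R : realType) (i : nat) (y : R) :
  0 <= y <= 1 -> 0 <= iter i (@tent R) y <= 1.
Proof. by move=> y01; elim: i => //= i; exact: tent_itv. Qed.

(** Two itineraries of y can differ only at a time when the orbit is at 1/2.
    From there it runs to 1, then to 0, where it stays; but 0 admits only the
    bit 0, so a sequence with infinitely many ones excludes this. *)
Lemma itinerary_inj (R : realType) (y : R) (e e' : nat -> bool) :
  0 <= y <= 1 -> (forall n, itinerary n e y) -> (forall n, itinerary n e' y) ->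
  (forall n, exists2 i, (n <= i)%N & e i) -> e =1 e'.
Proof.
move=> y01 he he' einf i; apply/eqP/negPn/negP => neq.
pose x j := iter j (@tent R) y.
have xi : x i = 1 / 2.
  have := he _ _ (ltnSn i); have := he' _ _ (ltnSn i).
  rewrite /on_side -/(x i).
  by move: neq; case: (e i); case: (e' i) => // _; lra.
(* The orbit continues 1/2, 1, 0, 0, ... from time i on. *)
have x0 k : x (i + k.+2)%N = 0.
  elim: k => [|k IH].
    rewrite addn2 /x !iterS -/(x i) xi /tent.
    have -> : 2 * (1 / 2) - 1 = 0 :> R by lra.
    by rewrite normr0 subr0 ger0_norm; lra.
  by rewrite addnS /x iterS -/(x _) IH /tent mulr0 sub0r normrN normr1 subrr.
have [j lej ej] := einf i.+2.
have := he _ _ (ltnSn j); rewrite /on_side ej -/(x j).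
have -> : x j = 0 by rewrite (_ : j = i + (j - i.+2).+2)%N ?x0 //; lia.
by lra.
Qed.

(** * Orbit sums along an itinerary *)

Definition ones (e : nat -> bool) (n : nat) : nat := \sum_(i < n) e i.

(** The predecessor 0.-1 = 0 makes the first term vanish.  Looking backwards
    rather than forwards keeps the count up to n dependent on the first n bits
    only, as needed when a prefix is repeated periodically. *)
Definition switches (e : nat -> bool) (n : nat) : nat :=
  \sum_(i < n) (e i.-1 != e i).

Definition orbit_sum (R : realType) (y : R) (n : nat) : R :=
  \sum_(i < n) iter i (@tent R) y.

(** Summation by parts of x_i = 2/3 e_i + h(e_i) (x_(i+1) - x_i): the boundary
    term is at most 1, and each switch costs |h(0) - h(1)| = 4/3. *)
Lemma orbit_sum_itinerary (R : realType) (n : nat) (e : nat -> bool) (y : R) :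
  0 <= y <= 1 -> itinerary n e y ->
  `|orbit_sum y n - 2 / 3 * (ones e n)%:R| <= 2 * (1 + (switches e n)%:R).
Proof.
move=> y01; pose h b : R := if b then - (1 / 3) else 1.
have h1 b x : 0 <= x <= 1 -> `|h b * x| <= 1 :> R.
  by rewrite ler_norml /h; case: b; lra.
(* Keeping the boundary term h(e_(n-1)) x_n on the left, the left-hand side is
   unchanged by a step without switch. *)
suff IH : itinerary n e y ->
    `|orbit_sum y n - 2 / 3 * (ones e n)%:R - h (e n.-1) * iter n (@tent R) y|
    <= 1 + 4 / 3 * (switches e n)%:R.
  move=> /IH; have := h1 (e n.-1) _ (iter_tent_itv n y01).
  have : 0 <= (switches e n)%:R :> R by [].
  by rewrite !ler_norml; lra.
elim: n => [_|n IH hn].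
  rewrite /orbit_sum /ones /switches !big_ord0 /= !mulr0 addr0 subr0 sub0r normrN.
  exact: h1.
have {}IH := IH (fun i lti => hn i (ltnW lti)).
rewrite /orbit_sum /ones /switches !big_ord_recr /= -/(orbit_sum y n)
  -/(ones e n) -/(switches e n) !natrD.
rewrite (tent_on_side (hn n (ltnSn n))).
have := iter_tent_itv n y01; set x := iter n _ y in IH *.
move: IH; rewrite /h !ler_norml.
by case: (e n.-1); case: (e n) => /=; rewrite ?mulr0n ?mulr1n; lra.
Qed.

(** Sum 3 x <= 2 + x - T x, which is [tent_le], along the orbit. *)
Lemma orbit_sum_le (R : realType) (y : R) (n : nat) :
  3 * orbit_sum y n <= 2 * n%:R + y - iter n (@tent R) y.
Proof.
elim: n => [|n IH]; first by rewrite /orbit_sum big_ord0 /=; lra.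
rewrite /orbit_sum big_ord_recr /= -/(orbit_sum y n).
by have := tent_le (iter n (@tent R) y); rewrite -natr1; lra.
Qed.

Lemma orbit_sum_itv (R : realType) (y : R) (n : nat) :
  0 <= y <= 1 -> 0 <= orbit_sum y n <= n%:R.
Proof.
move=> y01; elim: n => [|n]; first by rewrite /orbit_sum big_ord0 lexx.
rewrite /orbit_sum big_ord_recr -/(orbit_sum y n) /=.
by have := iter_tent_itv n y01; rewrite -natr1; lra.
Qed.

(** * Mass centers *)

Lemma mass_centerE (R : realType) (y : R) (n : nat) :
  arithmetic_mean (fun i => iter i (@tent R) y) n =
  n.+1%:R^-1 * orbit_sum y n.+1.
Proof. by rewrite /arithmetic_mean /= /series /= /orbit_sum big_mkord. Qed.

Lemma mass_center_itv (R : realType) (y m : R) :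
  0 <= y <= 1 -> is_mass_center y m -> 0 <= m <= 2 / 3.
Proof.
move=> y01 ym.
have mean0 n : 0 <= n.+1%:R^-1 * orbit_sum y n.+1.
  by rewrite mulr_ge0 // ?invr_ge0 //; have /andP[] := orbit_sum_itv n.+1 y01.
apply/andP; split.
  by apply: (cvgr_to_ge ym); apply: nearW => n; rewrite mass_centerE.
have /cvgr_to_le : arithmetic_mean (fun i => iter i (@tent R) y) n - harmonic n
    @[n --> \oo] --> m.
  by rewrite -[m]subr0; exact: cvgB ym (@cvg_harmonic R).
apply.
apply: nearW => n; rewrite mass_centerE /= lerBlDr.
rewrite mulrC ler_pdivrMr // mulrDl mulVf ?pnatr_eq0 //.
by have := orbit_sum_le y n.+1; have := iter_tent_itv n.+1 y01; lra.
Qed.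

Lemma mean_error_sqr (R : realFieldType) (S m C : R) (k n : nat) :
  (k ^ 2 <= n)%N -> `|S - m * n%:R| <= C * k.+1%:R -> (0 < n)%N ->
  `|m - n%:R^-1 * S| ^+ 2 <= 4 * C ^+ 2 / n%:R.
Proof.
move=> kn hS n0.
have n0R : 0 < n%:R :> R by rewrite ltr0n.
have -> : m - n%:R^-1 * S = - (S - m * n%:R) / n%:R by field; rewrite gt_eqF.
rewrite normrM normrN normfV normr_nat exprMn exprVn.
rewrite ler_pdivrMr ?exprn_gt0 //.
have -> : 4 * C ^+ 2 / n%:R * n%:R ^+ 2 = C ^+ 2 * (4 * n%:R).
  by field; rewrite gt_eqF.
apply: (@le_trans _ _ ((C * k.+1%:R) ^+ 2)).
  by rewrite lerXn2r // ?nnegrE // (le_trans _ hS).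
(* (k + 1)^2 <= 2 (k^2 + 1) <= 4 n, as n > 0. *)
rewrite exprMn ler_wpM2l ?sqr_ge0 // -!natrX -natrM ler_nat.
by nia.
Qed.

(** An O(sqrt n) error in a sum of n terms gives a vanishing error in the mean.
    The threshold N depends on C and eps only, so the same bound serves for one
    orbit at all times and for a different cycle at each length. *)
Lemma mean_error_lt (R : realType) (C eps : R) : 0 < eps ->
  exists N : nat, forall (S m : R) (k n : nat),
    (k ^ 2 <= n)%N -> `|S - m * n%:R| <= C * k.+1%:R -> (N < n)%N ->
    `|m - n%:R^-1 * S| < eps.
Proof.
move=> e0; have e20 : 0 < eps ^+ 2 by rewrite exprn_gt0.
exists (Num.bound (4 * C ^+ 2 / eps ^+ 2)) => S m k n kn hS Nn.
have n0 : (0 < n)%N by lia.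
rewrite -(ltr_pXn2r (n := 2)) // ?nnegrE // ?ltW //.
apply: le_lt_trans (mean_error_sqr kn hS n0) _.
rewrite ltr_pdivrMr ?ltr0n // -ltr_pdivrMl // mulrC.
have /archi_boundP : 0 <= 4 * C ^+ 2 / eps ^+ 2.
  by apply: divr_ge0 (sqr_ge0 _); apply: mulr_ge0 (sqr_ge0 _).
move=> /lt_trans; apply.
by rewrite ltr_nat.
Qed.

Lemma is_mass_center_of_error (R : realType) (y m C : R) (k : nat -> nat) :
  (forall n, (k n ^ 2 <= n)%N) ->
  (forall n, `|orbit_sum y n - m * n%:R| <= C * (k n).+1%:R) ->
  is_mass_center y m.
Proof.
move=> kn hS; apply/cvgrPdist_lt => eps e0.
have [N hN] := mean_error_lt C e0.
exists N => // n /= leNn; rewrite mass_centerE.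
by apply: hN (kn n.+1) (hS n.+1) _; rewrite ltnS.
Qed.

(** * Realizing itineraries *)

(** The inverse branches of T are x / 2 and 1 - x / 2, that is
    x |-> e + (-1)^e x / 2; composing them along e gives the series with general
    term (-1)^(e_0 + ... + e_(k-1)) e_k / 2^k. *)
Fixpoint signed_digit (R : realType) (e : nat -> bool) (k : nat) : R :=
  if k is k'.+1 then
    (if e 0%N then - (1 / 2) else 1 / 2) * signed_digit R (fun i => e i.+1) k'
  else (e 0%N)%:R.

Definition coded_point (R : realType) (e : nat -> bool) : R :=
  limn (series (signed_digit R e)).

Lemma signed_digit_le (R : realType) (e : nat -> bool) (k : nat) :
  `|signed_digit R e k| <= geometric 1 (1 / 2) k.
Proof.
rewrite /= mul1r; elim: k e => [|k IH] e /=.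
  by rewrite expr0; case: (e 0%N); rewrite ?normr1 ?normr0.
rewrite normrM exprS; apply: ler_pM (normr_ge0 _) (normr_ge0 _) _ (IH _).
by case: (e 0%N); rewrite ?normrN ger0_norm //; lra.
Qed.

Lemma cvg_signed_digit (R : realType) (e : nat -> bool) :
  cvgn (series (signed_digit R e)).
Proof.
apply: normed_cvg.
apply: series_le_cvg (signed_digit_le R e) _ => [n|n|].
- exact: normr_ge0.
- exact: le_trans (normr_ge0 _) (signed_digit_le R e n).
- by apply: is_cvg_geometric_series; rewrite ger0_norm; lra.
Qed.

Lemma series_signed_digitS (R : realType) (e : nat -> bool) (n : nat) :
  series (signed_digit R e) n.+1 =
  (e 0%N)%:R + (if e 0%N then - (1 / 2) else 1 / 2) *
               series (signed_digit R (fun i => e i.+1)) n.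
Proof.
by rewrite /series /= big_nat_recl //= mulr_sumr.
Qed.

Lemma coded_point_itv (R : realType) (e : nat -> bool) :
  0 <= coded_point R e <= 1.
Proof.
have bound n : 0 <= series (signed_digit R e) n <= 1.
  elim: n e => [|n IH] e; first by rewrite /series /= big_geq // lexx ler01.
  rewrite series_signed_digitS; have := IH (fun i => e i.+1).
  by case: (e 0%N) => /=; rewrite ?mulr0n ?mulr1n; lra.
have h := @cvg_signed_digit R e; apply/andP; split.
  by apply: limr_ge h _; apply: nearW => n; have /andP[] := bound n.
by apply: limr_le h _; apply: nearW => n; have /andP[] := bound n.
Qed.

(** The value of the series is obtained from that of the shifted sequence by the
    inverse branch of T selected by the first bit. *)
Lemma coded_pointS (R : realType) (e : nat -> bool) :
  coded_point R e =
  (e 0%N)%:R + (if e 0%N then - (1 / 2) else 1 / 2) *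
               coded_point R (fun i => e i.+1).
Proof.
set c := if _ then _ else _.
have h := @cvg_signed_digit R (fun i => e i.+1).
have : series (signed_digit R e) n.+1 @[n --> \oo] -->
    (e 0%N)%:R + c * coded_point R (fun i => e i.+1).
  under eq_fun do rewrite series_signed_digitS.
  by apply: cvgD; [exact: cvg_cst | apply: cvgMr].
by rewrite (cvg_shiftS (series (signed_digit R e))) => /cvg_lim; apply.
Qed.

Lemma coded_point_side (R : realType) (e : nat -> bool) :
  on_side (e 0%N) (coded_point R e) /\
  tent (coded_point R e) = coded_point R (fun i => e i.+1).
Proof.
have /andP[z0 z1] := coded_point_itv R (fun i => e i.+1).
have side : on_side (e 0%N) (coded_point R e).
  rewrite coded_pointS /on_side; case: (e 0%N) => /=; rewrite ?mulr1n ?mulr0n; lra.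
split => //; rewrite (tent_on_side side) coded_pointS.
by case: (e 0%N) => /=; rewrite ?mulr1n ?mulr0n; lra.
Qed.

Lemma iter_tent_coded_point (R : realType) (i : nat) (e : nat -> bool) :
  iter i (@tent R) (coded_point R e) = coded_point R (fun j => e (i + j)%N).
Proof.
elim: i => // i IH; rewrite iterS IH (coded_point_side R _).2.
by congr coded_point; apply: funext => j; rewrite addnS.
Qed.

Lemma coded_point_itinerary (R : realType) (e : nat -> bool) (n : nat) :
  itinerary n e (coded_point R e).
Proof.
move=> i _; rewrite iter_tent_coded_point.
by have [] := coded_point_side R (fun j => e (i + j)%N); rewrite addn0.
Qed.

(** * Bit sequences with prescribed density *)

(** State before the bit at time n is emitted: [block] is the k such that
    (k + 1)^2 is the next square at which the free bit number k is emitted,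
    [count] the number of ones so far, and [cur] the bit repeated until then. *)
Record greedy_state := GreedyState { block : nat; count : nat; cur : bool }.

Definition at_mark (n : nat) (s : greedy_state) : bool :=
  n == ((block s).+1 ^ 2)%N.

Definition emit (a : nat -> bool) (n : nat) (s : greedy_state) : bool :=
  if at_mark n s then a (block s) else cur s.

Fixpoint greedy (R : realType) (d : R) (a : nat -> bool) (n : nat) :
    greedy_state :=
  if n is n'.+1 then
    let s := greedy d a n' in
    let b := emit a n' s in
    if at_mark n' s then
      GreedyState (block s).+1 (count s + b) ((count s)%:R <= d * n'%:R)
    else GreedyState (block s) (count s + b) (cur s)
  else GreedyState 0 0 true.

Definition greedy_bit (R : realType) (d : R) (a : nat -> bool) (n : nat) : bool :=
  emit a n (greedy d a n).

Lemma count_greedy (R : realType) (d : R) (a : nat -> bool) (n : nat) :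
  count (greedy d a n) = ones (greedy_bit d a) n.
Proof.
elim: n => [|n IH]; first by rewrite /ones big_ord0.
by rewrite /ones big_ord_recr -/(ones _ n) -IH /=; case: ifP.
Qed.

(** The predecessor is there to make k unique: at a square n = (k + 1)^2 the
    state is still that of block k. *)
Lemma block_greedy (R : realType) (d : R) (a : nat -> bool) (n : nat) :
  let k := block (greedy d a n) in (k ^ 2 <= n.-1 /\ n <= k.+1 ^ 2)%N.
Proof.
elim: n => //= n [h1 h2]; case: ifP => /= /eqP h; nia.
Qed.

(** Each square allows two switches, one into the free bit and one out of it.
    The invariant of the induction charges in advance the switch, if any, from
    the last emitted bit to the current one. *)
Lemma switches_greedy (R : realType) (d : R) (a : nat -> bool) (n : nat) :
  (switches (greedy_bit d a) n <= (block (greedy d a n)).*2.+1)%N.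
Proof.
suff : (switches (greedy_bit d a) n
        + (greedy_bit d a n.-1 != cur (greedy d a n))
        <= (block (greedy d a n)).*2.+1)%N by lia.
elim: n => [|n IH]; first by rewrite /switches big_ord0.
rewrite /switches big_ord_recr -/(switches _ n) /=.
have := erefl (greedy_bit d a n); rewrite {2}/greedy_bit /emit.
case: ifP => _ /= eb; last by rewrite eb eqxx addn0.
rewrite doubleS; move: IH.
by do 2![case: (_ != _)]; case: (_ != _) => /=; lia.
Qed.

(** Inside a block of ones the discrepancy starts at most 0 and can rise only by
    the time t elapsed since the last square; symmetrically for zeros.  At the
    end of block k we have t <= 2 k + 1, so the next block starts within the
    claimed bound, and a free bit changes the discrepancy by at most 1. *)
Lemma ones_greedy (R : realType) (d : R) (a : nat -> bool) (n : nat) :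
  0 <= d <= 1 ->
  `|(ones (greedy_bit d a) n)%:R - d * n%:R|
  <= 2 * (block (greedy d a n)).+1%:R.
Proof.
move=> /andP[d0 d1]; rewrite -count_greedy.
suff [] : let s := greedy d a n in
   let D : R := (count s)%:R - d * n%:R in
   let t : R := n%:R - (block s)%:R ^+ 2 in
   n%:R <= (block s).+1%:R ^+ 2 :> R /\
   if cur s then - (2 * (block s).+1%:R) <= D <= t
   else - t <= D <= 2 * (block s).+1%:R.
  move=> /=; case: cur; rewrite ler_norml -natr1; nra.
split; first by rewrite -natrX ler_nat (block_greedy d a n).2.
elim: n => [|n]; first by rewrite /=; lra.
have := (block_greedy d a n).2.
move=> /=; rewrite /emit /at_mark; case: greedy => k c b /=.
rewrite -(ler_nat R) natrX => hn.
case: eqP => [e|_] /= IH.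
  have {hn} : n%:R = k.+1%:R ^+ 2 :> R by rewrite e natrX.
  have : 0 <= ((a k)%:R : R) <= 1 by case: (a k); rewrite ?mulr0n ?mulr1n; lra.
  have k0 : 0 <= k%:R :> R by [].
  have n0 : 0 <= n%:R :> R by [].
  move: IH; rewrite natrD -!natr1.
  by case: b; case: (lerP c%:R (d * n%:R)) => /=; lra.
by move: IH; rewrite natrD -!natr1; case: b => /=; rewrite ?mulr0n ?mulr1n; nra.
Qed.

Lemma greedy_bit_mark (R : realType) (d : R) (a : nat -> bool) (k : nat) :
  greedy_bit d a (k.+1 ^ 2) = a k.
Proof.
have [h1 h2] := block_greedy d a (k.+1 ^ 2).
have bk : block (greedy d a (k.+1 ^ 2)) = k by nia.
by rewrite /greedy_bit /emit /at_mark bk eqxx.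
Qed.

(** * Orbits with a prescribed mass center *)

Lemma greedy_orbit_sum (R : realType) (d y : R) (a : nat -> bool) (n : nat) :
  0 <= d <= 1 -> 0 <= y <= 1 -> itinerary n (greedy_bit d a) y ->
  `|orbit_sum y n - 2 / 3 * d * n%:R| <= 6 * (block (greedy d a n)).+1%:R.
Proof.
move=> d01 y01 /(orbit_sum_itinerary y01).
have := ones_greedy a n d01.
have : (switches (greedy_bit d a) n)%:R
    <= 2 * (block (greedy d a n))%:R + 1 :> R.
  by rewrite -natrM natr1 ler_nat mul2n switches_greedy.
have : 0 <= (block (greedy d a n))%:R :> R by [].
by rewrite -natr1 !ler_norml; lra.
Qed.

Lemma block_greedy_le (R : realType) (d : R) (a : nat -> bool) (n : nat) :
  (block (greedy d a n) ^ 2 <= n)%N.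
Proof. exact: leq_trans (block_greedy d a n).1 (leq_pred n). Qed.

Lemma greedy_mass_center (R : realType) (d : R) (a : nat -> bool) :
  0 <= d <= 1 -> is_mass_center (coded_point R (greedy_bit d a)) (2 / 3 * d).
Proof.
move=> d01; apply: (is_mass_center_of_error (block_greedy_le d a)) => n.
apply: greedy_orbit_sum => //; first exact: coded_point_itv.
exact: coded_point_itinerary.
Qed.

Lemma orbit_sumD (R : realType) (y : R) (m n : nat) :
  orbit_sum y (m + n) = orbit_sum y m + orbit_sum (iter m (@tent R) y) n.
Proof.
rewrite /orbit_sum big_split_ord /=; congr (_ + _).
by apply: eq_bigr => i _; rewrite addnC iterD.
Qed.

(** The discrepancy orbit_sum y n - m n is periodic in n, hence bounded. *)
Lemma periodic_mass_center (R : realType) (y : R) (p : nat) :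
  0 <= y <= 1 -> (0 < p)%N -> iter p (@tent R) y = y ->
  is_mass_center y (p%:R^-1 * orbit_sum y p).
Proof.
move=> y01 p0 yp; set m := _^-1 * _.
have p0R : 0 < p%:R :> R by rewrite ltr0n.
have mp : orbit_sum y p = m * p%:R by rewrite /m; field; rewrite gt_eqF.
have /andP[m0 m1] : 0 <= m <= 1.
  have /andP[s0 s1] := orbit_sum_itv p y01.
  by rewrite /m mulr_ge0 ?invr_ge0 //= mulrC ler_pdivrMr // mul1r.
apply: (@is_mass_center_of_error R y m p%:R (fun=> 0%N)) => // n.
rewrite mulr1; elim/ltn_ind: n => n IH; have [ltnp|lepn] := ltnP n p.
  have := orbit_sum_itv n y01; have : n%:R <= p%:R :> R by rewrite ler_nat ltnW.
  have : 0 <= n%:R :> R by [].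
  by rewrite ler_norml; nra.
rewrite -(subnKC lepn) orbit_sumD yp natrD.
have := IH (n - p)%N; rewrite mp => {}IH.
suff -> : m * p%:R + orbit_sum y (n - p) - m * (p%:R + (n - p)%:R)
  = orbit_sum y (n - p) - m * (n - p)%:R by apply: IH; lia.
by ring.
Qed.

(** The cycle coded by the repeated prefix of length p has the orbit sum over one
    period estimated by [greedy_orbit_sum], which only uses the first p bits. *)
Lemma exists_cycle_near (R : realType) (d eps : R) :
  0 <= d <= 1 -> 0 < eps ->
  exists2 m, cycle_mass_centers R m & `|2 / 3 * d - m| < eps.
Proof.
move=> d01 e0; pose b := greedy_bit d xpred0.
have [N hN] := mean_error_lt 6 e0.
pose p := N.+1; pose y := coded_point R (fun i => b (i %% p)%N).
have y01 : 0 <= y <= 1 by exact: coded_point_itv.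
have yp : iter p (@tent R) y = y.
  rewrite iter_tent_coded_point; congr coded_point.
  by apply: funext => j; rewrite modnDl.
exists (p%:R^-1 * orbit_sum y p).
  exists y; split; rewrite ?in_itv //; first by exists p.
  exact: periodic_mass_center.
apply: hN (block_greedy_le d xpred0 p) _ (ltnSn N).
apply: greedy_orbit_sum => // i ltip.
have := @coded_point_itinerary R (fun i => b (i %% p)%N) p i ltip.
by rewrite modn_small.
Qed.

Lemma cantor_nat (f : (nat -> bool) -> nat) : ~ injective f.
Proof.
move=> finj; pose w n := ~~ `[< exists2 v, f v = n & v n >].
have := erefl (w (f w)); rewrite {1}/w.
case: asboolP => [[v /finj -> ->]//|nw] /esym ww.
by apply: nw; exists w.
Qed.

Lemma countable_tent_orbit (R : realType) (y : R) : countable (tent_orbit y).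
Proof.
apply: (@sub_countable _ _ _ [set: nat]); last exact: countableP.
apply: (@card_le_trans _ _ _ (range (fun i => iter i (@tent R) y))).
  by apply: subset_card_le => _ [i ->]; exists i.
exact: card_image_le.
Qed.

(** The odd-indexed free bits are set to 1 so that the sequence has infinitely
    many ones, which makes the coding injective by [itinerary_inj]; the
    even-indexed ones carry w. *)
Definition tagged_bits (w : nat -> bool) (k : nat) : bool := odd k || w k./2.

Lemma greedy_point_inj (R : realType) (d : R) :
  injective (fun w => coded_point R (greedy_bit d (tagged_bits w))).
Proof.
move=> w w' /= eqy; apply: funext => j.
have he := coded_point_itinerary R (greedy_bit d (tagged_bits w)).
have he' := coded_point_itinerary R (greedy_bit d (tagged_bits w')).
rewrite -eqy in he'.
have := itinerary_inj (coded_point_itv R _) he he'.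
have inf n : exists2 i, (n <= i)%N & greedy_bit d (tagged_bits w) i.
  exists ((n.*2.+1).+1 ^ 2)%N; first by nia.
  by rewrite greedy_bit_mark /tagged_bits /= odd_double.
move=> /(_ inf (j.*2.+1 ^ 2)%N).
by rewrite !greedy_bit_mark /tagged_bits odd_double doubleK.
Qed.

Theorem theorem3 (R : realType) :
  [/\ mass_centers R = `[0, 2 / 3]%classic,
      cycle_mass_centers R `<=` `[0, 2 / 3]%classic
        /\ `[0, 2 / 3]%classic `<=` closure (cycle_mass_centers R) &
      forall x : R, x \in `[0, 2 / 3] ->
        ~ countable (orbits_with_mass_center x)].
Proof.
have density (x : R) : 0 <= x <= 2 / 3 ->
    exists2 d, 0 <= d <= 1 & x = 2 / 3 * d.
  by move=> x01; exists (3 / 2 * x); lra.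
split.
- apply/seteqP; split => x /=.
    by rewrite in_itv => -[y]; rewrite in_itv; exact: mass_center_itv.
  rewrite in_itv => /density[d d01 ->].
  exists (coded_point R (greedy_bit d xpred0)); last exact: greedy_mass_center.
  by rewrite in_itv; exact: coded_point_itv.
- split=> x /=; rewrite in_itv.
    by move=> -[y [y01 _]]; apply: mass_center_itv; move: y01; rewrite in_itv.
  move=> /density[d d01 ->] B /nbhs_ballP[eps /= e0 epsB].
  have [m cm dm] := exists_cycle_near d01 e0.
  by exists m; split=> //; apply: epsB.
- move=> x; rewrite in_itv => /density[d d01 ->] cO.
  have cpts : countable
      (\bigcup_(O in orbits_with_mass_center (2 / 3 * d)) O).
    apply: bigcup_countable cO _ => _ [y [_ _ ->]].
    exact: countable_tent_orbit.
  have /countable_injP[f finj] := cpts.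
  pose y w := coded_point R (greedy_bit d (tagged_bits w)).
  have yin w : y w \in \bigcup_(O in orbits_with_mass_center (2 / 3 * d)) O.
    rewrite inE; exists (tent_orbit (y w)); last by exists 0%N.
    exists (y w); split => //; last exact: greedy_mass_center.
    by rewrite in_itv; exact: coded_point_itv.
  apply: (@cantor_nat (f \o y)) => w w' /(finj _ _ (yin w) (yin w')).
  exact: greedy_point_inj.
Qed.
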